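(* There are no closed (compact without boundary) horo-shrinkers in $\mathbb{H}^3$.
   Context: $\mathbb{H}^3$ is the upper half-space $\mathbb{R}^3_+=\{(x,y,z): z>0\}$ with the metric $\langle\cdot,\cdot\rangle=\frac{1}{z^2}(dx^2+dy^2+dz^2)$. A horo-shrinker is an isometric immersion $\Psi:\Sigma\to\mathbb{H}^3$ of an oriented smooth (nonempty) surface $\Sigma$ whose mean curvature $H$ satisfies $H=\langle N,\partial_z\rangle$, where $N$ is the unit normal. Here $H$ is the average of the principal curvatures, with the sign convention that the horosphere $z=c$ with $N=c\,\partial_z$ has $H=1$; equivalently $H=zH_e+(N^e)_3$, where $H_e$ is the Euclidean mean curvature, $N^e=N/z$ is the Euclidean unit normal and $(\cdot)_3$ is the third coordinate. *)

(* Defs.v *)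
From HB Require Import structures.
From mathcomp Require Import all_boot all_order all_algebra.
From mathcomp Require Import all_classical all_reals all_analysis.

Set Implicit Arguments.
Unset Strict Implicit.
Unset Printing Implicit Defensive.

Import Order.TTheory GRing.Theory Num.Theory numFieldNormedType.Exports.
Local Open Scope classical_set_scope.
Local Open Scope ring_scope.

(** * Calculus on open subsets of [R^n] *)

Definition partial (R : realType) (n : nat) (i : 'I_n.+1)
    (f : 'rV[R]_n.+1 -> R) : 'rV[R]_n.+1 -> R :=
  fun x => 'D_(delta_mx 0 i) f x.

Fixpoint class_C (R : realType) (n k : nat) (U : set 'rV[R]_n.+1)
    (f : 'rV[R]_n.+1 -> R) : Prop :=
  (forall x, U x -> {for x, continuous f}) /\
  (if k is k'.+1 then
     forall i, (forall x, U x -> derivable f x (delta_mx 0 i)) /\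
               class_C k' U (partial i f)
   else True).

(* [U] is meant to be open. *)
Definition smooth_on (R : realType) (n m : nat) (U : set 'rV[R]_n.+1)
    (f : 'rV[R]_n.+1 -> 'rV[R]_m.+1) : Prop :=
  forall (j : 'I_m.+1) (k : nat), class_C k U (fun x => f x 0 j).

(* Row [i] is the partial derivative of [f] in the direction [i], so that the
   differential of [f] at [x] is [v |-> v *m diffmx f x]. *)
Definition diffmx (R : realType) (n m : nat)
    (f : 'rV[R]_n.+1 -> 'rV[R]_m.+1) (x : 'rV[R]_n.+1) : 'M[R]_(n.+1, m.+1) :=
  \matrix_(i, j) partial i (fun y => f y 0 j) x.

(** * Smooth surfaces *)

(* A chart is a homeomorphism from an open set of [S] onto an open set of
   [R^2]; [chart_inv] only matters on the image of [chart_map]. *)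
Record chart (R : realType) (S : topologicalType) := Chart {
  chart_dom : set S;
  chart_map : S -> 'rV[R]_2;
  chart_inv : 'rV[R]_2 -> S;
  chart_dom_open : open chart_dom;
  chart_cod_open : open (chart_map @` chart_dom);
  chart_mapK : forall s, chart_dom s -> chart_inv (chart_map s) = s;
  chart_map_continuous : {within chart_dom, continuous chart_map};
  chart_inv_continuous :
    {within chart_map @` chart_dom, continuous chart_inv} }.

Definition chart_cod (R : realType) (S : topologicalType) (c : chart R S) :
    set 'rV[R]_2 :=
  chart_map c @` chart_dom c.

Definition overlap (R : realType) (S : topologicalType) (c d : chart R S) :
    set 'rV[R]_2 :=
  chart_map c @` (chart_dom c `&` chart_dom d).

Definition transition (R : realType) (S : topologicalType) (c d : chart R S) :
    'rV[R]_2 -> 'rV[R]_2 :=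
  chart_map d \o chart_inv c.

(* Charts have open images in [R^2], so these surfaces have no boundary.
   The orientation is the one for which all charts of [A] are positive. *)
Definition oriented_surface (R : realType) (S : topologicalType)
    (A : set (chart R S)) : Prop :=
  [/\ [set: S] !=set0,
      hausdorff_space S /\ @second_countable S,
      \bigcup_(c in A) chart_dom c = [set: S],
      (forall c d, A c -> A d -> smooth_on (overlap c d) (transition c d)) &
      (forall c d x, A c -> A d -> overlap c d x ->
         0 < \det (diffmx (transition c d) x))].

Definition closed_oriented_surface (R : realType) (S : topologicalType)
    (A : set (chart R S)) : Prop :=
  oriented_surface A /\ compact [set: S].

(* [g c x] is the matrix of the metric in the chart [c] at the point with
   coordinates [x]. *)
Definition riemannian_metric (R : realType) (S : topologicalType)
    (A : set (chart R S)) (g : chart R S -> 'rV[R]_2 -> 'M[R]_2) : Prop :=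
  [/\ (forall c i j k, A c -> class_C k (chart_cod c) (fun x => g c x i j)),
      (forall c x, A c -> chart_cod c x -> (g c x)^T = g c x),
      (forall c x (v : 'rV[R]_2), A c -> chart_cod c x -> v != 0 ->
         0 < (v *m g c x *m v^T) 0 0) &
      (forall c d x, A c -> A d -> overlap c d x ->
         let J := diffmx (transition c d) x in
         g c x = J *m g d (transition c d x) *m J^T)].

(** * The upper half-space model of hyperbolic space *)

Definition height (R : realType) (p : 'rV[R]_3) : R := p 0 ord_max.

Definition H3 (R : realType) : set 'rV[R]_3 := [set p | 0 < height p].

Definition hyp_metric (R : realType) (p : 'rV[R]_3) : 'M[R]_3 :=
  (height p ^- 2)%:M.

Definition hyp_dot (R : realType) (p u v : 'rV[R]_3) : R :=
  (u *m hyp_metric p *m v^T) 0 0.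

Definition hyp_norm (R : realType) (p u : 'rV[R]_3) : R :=
  Num.sqrt (hyp_dot p u u).

Definition d_z (R : realType) : 'rV[R]_3 := delta_mx 0 ord_max.

(* Christoffel symbols [Gamma^k_ij] of the Levi-Civita connection. *)
Definition christoffel (R : realType) (k i j : 'I_3) (p : 'rV[R]_3) : R :=
  2^-1 * \sum_(l < 3) invmx (hyp_metric p) k l *
    (partial i (fun q => hyp_metric q j l) p
     + partial j (fun q => hyp_metric q i l) p
     - partial l (fun q => hyp_metric q i j) p).

(* Indices are added in ['I_3], that is, modulo 3. *)
Definition cross (R : realType) (u v : 'rV[R]_3) : 'rV[R]_3 :=
  \row_k (u 0 (k + 1) * v 0 (k + 2) - u 0 (k + 2) * v 0 (k + 1)).

(** * Local geometry of a parametrized surface [X] in [H3] *)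

Definition first_form (R : realType) (X : 'rV[R]_2 -> 'rV[R]_3)
    (x : 'rV[R]_2) : 'M[R]_2 :=
  diffmx X x *m hyp_metric (X x) *m (diffmx X x)^T.

(* As the metric is conformal to the Euclidean one, the Euclidean cross product
   is orthogonal to the surface for the hyperbolic metric. *)
Definition unit_normal (R : realType) (X : 'rV[R]_2 -> 'rV[R]_3)
    (x : 'rV[R]_2) : 'rV[R]_3 :=
  let n := cross (row 0 (diffmx X x)) (row 1 (diffmx X x)) in
  (hyp_norm (X x) n)^-1 *: n.

(* Covariant derivative along [X], in the direction [i], of the vector field
   [partial j X]. *)
Definition cov_diff2 (R : realType) (X : 'rV[R]_2 -> 'rV[R]_3) (i j : 'I_2)
    (x : 'rV[R]_2) : 'rV[R]_3 :=
  \row_k (partial i (fun y => diffmx X y j k) x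
          + \sum_(a < 3) \sum_(b < 3)
              christoffel k a b (X x) * diffmx X x i a * diffmx X x j b).

Definition second_form (R : realType) (X : 'rV[R]_2 -> 'rV[R]_3)
    (x : 'rV[R]_2) : 'M[R]_2 :=
  \matrix_(i, j) hyp_dot (X x) (cov_diff2 X i j x) (unit_normal X x).

(* With this sign the horosphere [z = c] with normal [c *: d_z] has principal
   curvatures 1. *)
Definition shape_operator (R : realType) (X : 'rV[R]_2 -> 'rV[R]_3)
    (x : 'rV[R]_2) : 'M[R]_2 :=
  invmx (first_form X x) *m second_form X x.

(* The eigenvalues of the shape operator, with multiplicity. *)
Definition principal_curvatures (R : realType) (X : 'rV[R]_2 -> 'rV[R]_3)
    (x : 'rV[R]_2) (k1 k2 : R) : Prop :=
  char_poly (shape_operator X x) = ('X - k1%:P) * ('X - k2%:P).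

Definition mean_curvature_is (R : realType) (X : 'rV[R]_2 -> 'rV[R]_3)
    (x : 'rV[R]_2) (H : R) : Prop :=
  exists k1 k2 : R, principal_curvatures X x k1 k2 /\ H = (k1 + k2) / 2.

(** * Horo-shrinkers *)

Definition isometric_immersion (R : realType) (S : topologicalType)
    (A : set (chart R S)) (g : chart R S -> 'rV[R]_2 -> 'M[R]_2)
    (Psi : S -> 'rV[R]_3) : Prop :=
  (forall s, H3 (Psi s)) /\
  (forall c, A c ->
     let X := Psi \o chart_inv c in
     smooth_on (chart_cod c) X /\
     (forall x, chart_cod c x ->
        row_free (diffmx X x) /\ first_form X x = g c x)).

Definition horo_shrinker (R : realType) (S : topologicalType)
    (A : set (chart R S)) (g : chart R S -> 'rV[R]_2 -> 'M[R]_2)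
    (Psi : S -> 'rV[R]_3) : Prop :=
  [/\ oriented_surface A,
      riemannian_metric A g,
      isometric_immersion A g Psi &
      forall c x, A c -> chart_cod c x ->
        let X := Psi \o chart_inv c in
        mean_curvature_is X x (hyp_dot (X x) (unit_normal X x) (d_z R))].

(* Main.v *)
From mathcomp Require Import all_boot all_order all_algebra.
From mathcomp Require Import all_classical all_reals all_analysis.
From mathcomp Require Import ring lra.
Require Import Defs.

(** The idea is to look at the point of the surface that is farthest, in the
    Euclidean sense, from the vertical axis, that is, at a maximum of
    [x^2 + y^2], which exists by compactness.

    Let [P = (x, y, 0)].  At the maximum the gradient vanishes, so [P] is
    orthogonal to the surface: either [P = 0], or the normal is horizontal.
    The relation [H = z H_e + (N^e)_3] ([mean_curvature_normal]) turns the
    horo-shrinker equation into [z H_e = (1 / z - 1) (N^e)_3]: the Euclidean mean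
    curvature is a multiple of [(N^e)_3], so the pairing of [P] with the Euclidean
    mean curvature vector is a multiple of [(P . N^e) (N^e)_3 = P_3 = 0].  Hence,
    at that point, the Euclidean surface Laplacian of [x^2 + y^2] reduces to
    [2 |grad x|^2 + 2 |grad y|^2 = 2 (1 + (N^e)_3 ^ 2) > 0], whereas it cannot
    be positive at a maximum ([no_local_max]).

    Rather than with the Laplacian, the contradiction is derived from the second
    derivative test in three explicit directions of the parameter plane, whose
    sum is the trace of the Hessian for the induced metric ([no_max_coords]).
    This needs the chain rule for functions with continuous partial derivatives
    ([is_derive_partials]). *)

Set Implicit Arguments.
Unset Strict Implicit.
Unset Printing Implicit Defensive.

Import Order.TTheory GRing.Theory Num.Theory numFieldNormedType.Exports.
Local Open Scope classical_set_scope.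
Local Open Scope ring_scope.

(** * Directional derivatives and the second derivative test *)

(** Directional derivatives are derivatives along lines, which is how the
    one-variable mean value theorem enters below. *)
Lemma is_derive_line (R : realType) (V : normedModType R) (f : V -> R)
    (x v : V) (t df : R) :
  is_derive (t *: v + x) v f df ->
  is_derive t 1 (fun s : R => f (s *: v + x)) df.
Proof.
have E : (fun h : R => h^-1 *:
    (((fun s : R => f (s *: v + x)) \o shift t) (h *: 1) - f (t *: v + x)))
  = (fun h : R => h^-1 *: ((f \o shift (t *: v + x)) (h *: v)
                          - f (t *: v + x))).
  by apply/funext => h /=; rewrite [h *: 1]mulr1 scalerDl addrA.
by case=> df1 df2; apply: DeriveDef; rewrite /derivable /derive /= E.
Qed.

Lemma is_derive_scaled (R : realType) (V : normedModType R) (f : V -> R)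
    (x v : V) (a df : R) :
  is_derive x v f df -> is_derive x (a *: v) f (a * df).
Proof.
move=> fv.
have f0 : is_derive (a * 0) 1 (fun s : R => f (s *: v + x)) df.
  by apply: is_derive_line; rewrite mulr0 scale0r add0r.
have a0 : is_derive (0 : R) 1 (fun s : R => a * s) a.
  by apply: is_derive_eq; rewrite [_ *: 1]mulr1.
have := is_derive1_comp f0 a0.
set g := (fun s : R => _) \o _ => -[g1 g2].
have E : (fun h : R => h^-1 *: ((g \o shift 0) (h *: 1) - g 0))
  = (fun h : R => h^-1 *: ((f \o shift x) (h *: (a *: v)) - f x)).
  apply/funext => h /=; rewrite /g /= mulr0 scale0r add0r addr0.
  by rewrite [h *: 1]mulr1 scalerA [h * a]mulrC.
by apply: DeriveDef; rewrite /derivable /derive -E // mulrC.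
Qed.

(** Moving by [h *: (v + w)] is moving by [h *: v], then by [h *: w].  The
    derivative of the first step is given; by the mean value theorem the second
    contributes [h] times a value of [d] at a point that tends to [x].  So
    continuity of [d], the derivative along [w], is what makes derivatives
    additive in the direction. *)
Lemma is_derive_addv (R : realType) (V : normedModType R) (f d : V -> R)
    (x v w : V) (df : R) :
  is_derive x v f df ->
  (\forall y \near x, is_derive y w f (d y)) ->
  {for x, continuous d} ->
  is_derive x (v + w) f (df + d x).
Proof.
move=> fv fw cw.
suff L : (fun h : R => h^-1 *: ((f \o shift x) (h *: (v + w)) - f x)) @ 0^'
    --> df + d x.
  by apply: DeriveDef; [apply/cvg_ex; eexists; exact: L | exact: cvg_lim L].
have -> : (fun h : R => h^-1 *: ((f \o shift x) (h *: (v + w)) - f x))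
  = (fun h : R => h^-1 *: ((f \o shift x) (h *: v) - f x))
  \+ (fun h : R => h^-1 *: (f (h *: w + (h *: v + x)) - f (h *: v + x))).
  apply/funext => h /=; rewrite -scalerDr; congr (_ *: _).
  have -> : h *: (v + w) + x = h *: w + (h *: v + x).
    by rewrite addrA -scalerDr (addrC w).
  by rewrite [RHS]addrC [RHS]addrA subrK.
apply: cvgD; first by case: fv => f1 <-; exact: f1.
apply/cvgrPdist_lt => e e0.
move/cvgrPdist_lt : cw => /(_ _ e0) cw.
have [r /= r0 rP] := iffLR (nbhs_normP _ _) (filterI fw cw).
near=> h.
have h0 : h != 0 by near: h; exact: nbhs_dnbhs_neq.
have hr (t : R) : 0 <= t <= 1 ->
    ball_ Num.norm x r (t *: (h *: w) + (h *: v + x)).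
  move=> /andP[t0 t1]; rewrite /ball_ /= addrA opprD addrCA subrr addr0 normrN.
  have hs : `|h| * (`|w| + `|v|) < r.
    have C0 : 0 < `|w| + `|v| + 1 by rewrite ltr_wpDl // addr_ge0.
    apply: (@le_lt_trans _ _ (`|h| * (`|w| + `|v| + 1))).
      by rewrite ler_wpM2l // lerDl.
    rewrite -ltr_pdivlMr //; near: h.
    by apply: dnbhs0_lt; rewrite divr_gt0.
  apply: le_lt_trans hs; apply: le_trans (ler_normD _ _) _.
  rewrite !normrZ mulrDr lerD2r ger0_norm //.
  by rewrite ler_piMl // mulr_ge0.
pose g (t : R) := f (t *: (h *: w) + (h *: v + x)).
have dg (t : R) : 0 <= t <= 1 ->
    is_derive t 1 g (h * d (t *: (h *: w) + (h *: v + x))).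
  move=> t01; apply: is_derive_line; apply: is_derive_scaled.
  exact: (rP _ (hr _ t01)).1.
have [||c c01] := @MVT R g
  (fun t : R => h * d (t *: (h *: w) + (h *: v + x))) 0 1 ltr01.
- by move=> t; rewrite in_itv /= => /andP[t0 t1]; apply: dg; rewrite !ltW.
- apply: derivable_within_continuous => t; rewrite in_itv /= => t01.
  by case: (dg _ t01).
rewrite /g scale1r scale0r add0r subr0 mulr1 => ->.
rewrite scalerAl [_ *: h]mulVf // mul1r.
apply: (rP _ (hr _ _)).2.
by move: c01; rewrite in_itv /= => /andP[? ?]; rewrite !ltW.
Unshelve. all: by end_near. Qed.

(** Along the line through [x] the first derivative vanishes at [0], so a
    positive second derivative would make the first derivative positive just to
    the right of [0], and [f] would increase there. *)
Lemma second_derivative_test (R : realType) (V : normedModType R) (f : V -> R)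
    (x v : V) :
  (\forall y \near x, f y <= f x) ->
  (\forall y \near x, derivable f y v) ->
  derivable ('D_v f) x v ->
  'D_v f x = 0 /\ 'D_v ('D_v f) x <= 0.
Proof.
move=> fmax fv dfv.
have [r /= r0 rP] := iffLR (nbhs_normP _ _) (filterI fmax fv).
(* Adding 1 keeps the radius positive when v = 0. *)
pose d := r / (`|v| + 1).
have d0 : 0 < d by rewrite divr_gt0 // ltr_wpDl.
have dP (t : R) : - d < t < d -> ball_ Num.norm x r (t *: v + x).
  move=> td; rewrite /ball_ /= opprD addrCA subrr addr0 normrN normrZ.
  have : `|t| < d by rewrite ltr_norml.
  rewrite /d ltr_pdivlMr; last by rewrite ltr_wpDl.
  by apply: le_lt_trans; rewrite ler_wpM2l // lerDl.
pose g (t : R) := f (t *: v + x); pose dg (t : R) := 'D_v f (t *: v + x).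
have gP (t : R) : - d < t < d -> is_derive t 1 g (dg t).
  move=> td; apply: is_derive_line; apply: derivableP.
  by case: (rP _ (dP _ td)).
have g0 : g 0 = f x by rewrite /g scale0r add0r.
have dg0 : dg 0 = 'D_v f x by rewrite /dg scale0r add0r.
have E0 : 'D_v f x = 0.
  have Nd0 : - d < 0 < d by rewrite oppr_lt0 d0.
  rewrite -dg0; have [_ <-] := gP _ Nd0.
  have [||||_ ->] := @derive1_at_max R g (- d) d 0.
  - by rewrite ge0_cp // ltW.
  - by move=> t; rewrite in_itv /= => /gP[].
  - by rewrite in_itv.
  - by move=> t; rewrite in_itv /= => /dP /rP[]; rewrite g0.
  - by [].
split; first exact: E0; rewrite leNgt; apply/negP => D0.
have : is_derive (0 : R) 1 dg ('D_v ('D_v f) x).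
  apply: (@is_derive_line R V ('D_v f) x v 0); rewrite scale0r add0r.
  exact: derivableP.
case=> c2 e2.
have : (fun h => h^-1 *: ((dg \o shift 0) (h *: 1) - dg 0)) @ 0^'
    --> 'D_v ('D_v f) x.
  by rewrite -e2; exact: c2.
move=> /cvgrPdist_lt /(_ _ D0) near0.
have [s s0 sP] : exists2 s : R, 0 < s & forall t : R, 0 < t < s -> 0 < dg t.
  move: near0; rewrite near_withinE => /nbhs_ballP[s s0 sP].
  exists s; [exact: s0 | move=> t /andP[t0 ts]].
  have : ball (0 : R) s t.
    by rewrite -ball_normE /ball_ /= sub0r normrN gtr0_norm.
  move=> /sP /(_ (lt0r_neq0 t0)) /=.
  rewrite addr0 [t *: 1]mulr1 dg0 E0 subr0 => H.
  have : 0 < t^-1 * dg t.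
    by move: H; rewrite ltr_norml => /andP[_]; rewrite gtrBl.
  have ti : 0 < t^-1 by rewrite invr_gt0.
  by move=> P; rewrite -(pmulr_rgt0 _ ti).
have [b b0 /andP[bs bd]] : exists2 b, 0 < b & (b < s) && (b < d).
  have : 0 < Num.min s d by rewrite lt_min s0.
  move/midf_lt => [m1 m2]; exists ((0 + Num.min s d) / 2); first exact: m1.
  by move: m2; rewrite lt_min.
have bin (t : R) : 0 <= t <= b -> - d < t < d.
  move=> /andP[t0 tb]; apply/andP; split; last exact: le_lt_trans tb bd.
  by apply: lt_le_trans t0; rewrite oppr_lt0.
have [||c] := @MVT R g dg 0 b b0.
- by move=> t; rewrite in_itv /= => /andP[t0 t1]; apply/gP/bin; rewrite !ltW.
- apply: derivable_within_continuous => t; rewrite in_itv /= => t01.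
  by case: (gP _ (bin _ t01)).
rewrite in_itv /= subr0 g0 => /andP[c0 cb] gb.
have : g b <= f x by apply: (rP _ (dP _ (bin _ _))).1; rewrite lexx ltW.
rewrite -subr_le0 gb leNgt (pmulr_lgt0 _ b0) => /negP; apply.
by apply: sP; rewrite c0 (lt_trans cb bs).
Qed.

(** The chain rule for [C^1] functions, obtained by adding the coordinate
    directions one at a time. *)
Lemma is_derive_partials (R : realType) (n : nat) (U : set 'rV[R]_n.+1)
    (f : 'rV[R]_n.+1 -> R) (x v : 'rV[R]_n.+1) :
  open U -> class_C 1 U f -> U x ->
  is_derive x v f (\sum_i v 0 i * partial i f x).
Proof.
move=> oU [_ fC] Ux; rewrite [v in is_derive x v]row_sum_delta.
elim: (index_enum _) => [|i s IH].
  by rewrite !big_nil; exact: is_derive0.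
rewrite !big_cons addrC [X in is_derive _ _ _ X]addrC.
have [fi [ci _]] := fC i.
apply: (is_derive_addv (d := fun y => v 0 i * partial i f y)) => //.
  apply: filterS (open_nbhs_nbhs (conj oU Ux)) => y Uy.
  by apply: is_derive_scaled; apply: derivableP; exact: fi.
exact: (cvgM (cvg_cst (v 0 i)) (ci _ Ux)).
Qed.

(** The mixed partial derivatives enter through their sum, exactly as they do in
    the trace of the second fundamental form. *)
Lemma is_derive2_partials (R : realType) (n : nat) (U : set 'rV[R]_n.+1)
    (f : 'rV[R]_n.+1 -> R) (x v : 'rV[R]_n.+1) :
  open U -> class_C 2 U f -> U x ->
  is_derive x v ('D_v f)
    (\sum_i \sum_j v 0 i * v 0 j * partial i (partial j f) x).
Proof.
move=> oU fC Ux.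
have f1 : class_C 1 U f.
  by case: fC => cf f2; split=> // i; have [? []] := f2 i.
have -> : \sum_i \sum_j v 0 i * v 0 j * partial i (partial j f) x =
    \sum_j v 0 j * \sum_i v 0 i * partial i (partial j f) x.
  rewrite exchange_big; apply: eq_bigr => j _; rewrite mulr_sumr.
  by apply: eq_bigr => i _; rewrite mulrA (mulrC (v 0 i)).
apply: (near_eq_is_derive (f := \sum_j (v 0 j *: partial j f))).
  apply: filterS (open_nbhs_nbhs (conj oU Ux)) => y Uy.
  have [_ ->] := is_derive_partials v oU f1 Uy.
  by rewrite fct_sumE.
apply: is_derive_sum => j; apply: is_deriveZ.
by apply: (is_derive_partials v oU _ Ux); exact: (fC.2 j).2.
Qed.

(** The second derivative test for [(p ^+ 2 + q ^+ 2) / 2], in the form used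
    for the two horizontal coordinates of a surface. *)
Lemma max_sum_sqr (R : realType) (V : normedModType R) (p q : V -> R)
    (x v : V) :
  (\forall y \near x, p y ^+ 2 + q y ^+ 2 <= p x ^+ 2 + q x ^+ 2) ->
  (\forall y \near x, derivable p y v /\ derivable q y v) ->
  derivable ('D_v p) x v -> derivable ('D_v q) x v ->
  p x * 'D_v p x + q x * 'D_v q x = 0 /\
  'D_v p x ^+ 2 + 'D_v q x ^+ 2
    + (p x * 'D_v ('D_v p) x + q x * 'D_v ('D_v q) x) <= 0.
Proof.
move=> fmax fD p2 q2.
pose f := p * p + q * q.
have [px qx] := nbhs_singleton fD.
have D1 y : derivable p y v /\ derivable q y v ->
    is_derive y v f (2 * (p y * 'D_v p y + q y * 'D_v q y)).
  move=> [py qy].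
  have ip := derivableP py; have iq := derivableP qy.
  apply: (is_derive_eq (is_deriveD (is_deriveM ip ip) (is_deriveM iq iq))).
  by rewrite /GRing.scale /=; ring.
have D2 : is_derive x v ('D_v f) (2 * ('D_v p x ^+ 2 + 'D_v q x ^+ 2
    + (p x * 'D_v ('D_v p) x + q x * 'D_v ('D_v q) x))).
  have ip := derivableP px; have iq := derivableP qx.
  have ip2 := derivableP p2; have iq2 := derivableP q2.
  have K := is_deriveZ 2 (is_deriveD (is_deriveM ip ip2) (is_deriveM iq iq2)).
  apply: is_derive_eq.
    apply: near_eq_is_derive K.
    by apply: filterS fD => y yD; have [_ ->] := D1 y yD.
  move: ('D_v ('D_v p) x) ('D_v ('D_v q) x) ('D_v p x) ('D_v q x).
  by move=> p'' q'' p' q'; rewrite /GRing.scale /=; ring.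
have [f1 f2] : 'D_v f x = 0 /\ 'D_v ('D_v f) x <= 0.
  apply: second_derivative_test.
  - by apply: filterS fmax => y; rewrite /f /= -!expr2.
  - by apply: filterS fD => y /D1[].
  - by case: D2.
have [_ e1] := D1 _ (conj px qx); have [_ e2] := D2.
have {e1} f1 := etrans (esym e1) f1.
have {e2} f2 := eq_ind _ (fun z => z <= 0) f2 _ e2.
move: ('D_v ('D_v p) x) ('D_v ('D_v q) x) ('D_v p x) ('D_v q x) f1 f2.
by move=> p'' q'' p' q' f1 f2; split; lra.
Qed.

(** * Coordinates in dimensions two and three *)

Lemma sum2E (V : nmodType) (F : 'I_2 -> V) : \sum_i F i = F 0 + F 1.
Proof.
rewrite big_ord_recl big_ord1; congr (_ + F _).
exact: val_inj.
Qed.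

Lemma sum22E (V : nmodType) (F : 'I_2 -> 'I_2 -> V) :
  \sum_i \sum_j F i j = F 0 0 + F 0 1 + F 1 0 + F 1 1.
Proof. by rewrite !sum2E addrA. Qed.

Lemma sum3E (V : nmodType) (F : 'I_3 -> V) :
  \sum_i F i = F 0 + F 1 + F ord_max.
Proof.
rewrite !big_ord_recl big_ord0 addr0 addrA; congr (_ + F _ + F _).
  exact: val_inj.
exact: val_inj.
Qed.

Lemma ord2P (P : 'I_2 -> Prop) : P 0 -> P 1 -> forall k, P k.
Proof.
move=> P0 P1 [[|[|//]] k2].
- by rewrite (_ : Ordinal k2 = 0) //; exact: val_inj.
- by rewrite (_ : Ordinal k2 = 1) //; exact: val_inj.
Qed.

Lemma ord3P (P : 'I_3 -> Prop) : P 0 -> P 1 -> P ord_max -> forall k, P k.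
Proof.
move=> P0 P1 P2 [[|[|[|//]]] k3].
- by rewrite (_ : Ordinal k3 = 0) //; exact: val_inj.
- by rewrite (_ : Ordinal k3 = 1) //; exact: val_inj.
- by rewrite (_ : Ordinal k3 = ord_max) //; exact: val_inj.
Qed.

Lemma crossE (R : realType) (u v : 'rV[R]_3) :
  [/\ cross u v 0 0 = u 0 1 * v 0 ord_max - u 0 ord_max * v 0 1,
      cross u v 0 1 = u 0 ord_max * v 0 0 - u 0 0 * v 0 ord_max &
      cross u v 0 ord_max = u 0 0 * v 0 1 - u 0 1 * v 0 0].
Proof.
have [e01 e02] : (0 + 1 = 1 :> 'I_3) /\ (0 + 2 = ord_max :> 'I_3).
  by split; apply: val_inj.
have [e11 e12] : (1 + 1 = ord_max :> 'I_3) /\ (1 + 2 = 0 :> 'I_3).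
  by split; apply: val_inj.
have [e21 e22] : (ord_max + 1 = 0 :> 'I_3) /\ (ord_max + 2 = 1 :> 'I_3).
  by split; apply: val_inj.
by split; rewrite mxE ?e01 ?e02 ?e11 ?e12 ?e21 ?e22.
Qed.

Definition dot3 (R : realType) (u v : 'rV[R]_3) : R :=
  u 0 0 * v 0 0 + u 0 1 * v 0 1 + u 0 ord_max * v 0 ord_max.

Lemma dot3_d_z (R : realType) (u : 'rV[R]_3) : dot3 u (d_z R) = u 0 ord_max.
Proof. by rewrite /dot3 !mxE /=; ring. Qed.

Lemma dot3_row (R : realType) (f : 'I_3 -> R) (n : 'rV[R]_3) :
  dot3 (\row_k f k) n = f 0 * n 0 0 + f 1 * n 0 1 + f ord_max * n 0 ord_max.
Proof. by rewrite /dot3 !mxE. Qed.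

(** Lagrange's identity: the Gram determinant of [u] and [v] is the squared
    length of their cross product. *)
Lemma dot3_cross (R : realType) (u v : 'rV[R]_3) :
  dot3 u u * dot3 v v - dot3 u v * dot3 v u
  = dot3 (cross u v) (cross u v).
Proof.
have [e0 e1 e2] := crossE u v.
by rewrite [dot3 (cross u v) _]/dot3 e0 e1 e2 /dot3; ring.
Qed.

Lemma dot3_gt0 (R : realType) (u : 'rV[R]_3) : u != 0 -> 0 < dot3 u u.
Proof.
move=> u0; rewrite lt_neqAle eq_sym /dot3 -!expr2 !addr_ge0 ?sqr_ge0 // andbT.
apply: contra u0 => /eqP E; apply/eqP/rowP.
have [e0 e1 e2] : [/\ u 0 0 ^+ 2 = 0, u 0 1 ^+ 2 = 0 & u 0 ord_max ^+ 2 = 0].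
  have := (sqr_ge0 (u 0 0), sqr_ge0 (u 0 1), sqr_ge0 (u 0 ord_max)).
  by move=> [[h0 h1] h2]; split; lra.
by elim/ord3P; rewrite mxE; apply/eqP; rewrite -sqrf_eq0 ?e0 ?e1 ?e2.
Qed.

(** By Lagrange's identity, [dot3 v v] times the squared length of the cross
    product is the squared length of the combination
    [dot3 v v *: u - dot3 u v *: v], which does not vanish when [u] and [v] are
    independent. *)
Lemma row_free_cross (R : realType) (J : 'M[R]_(2, 3)) : row_free J ->
  0 < dot3 (cross (row 0 J) (row 1 J)) (cross (row 0 J) (row 1 J)).
Proof.
move=> fJ; set u := row 0 J; set v := row 1 J.
have comb (s t : R) : (s != 0) || (t != 0) ->
    0 < dot3 (s *: u + t *: v) (s *: u + t *: v).
  move=> st; apply: dot3_gt0; pose w : 'rV[R]_2 := \row_i [:: s; t]`_i.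
  have -> : s *: u + t *: v = w *m J.
    by rewrite mulmx_sum_row sum2E !mxE.
  rewrite mulmx_free_eq0 //; apply: contraL st => /eqP w0.
  have /rowP w0' := w0; have := w0' 0; have := w0' 1; rewrite !mxE /= => -> ->.
  by rewrite eqxx.
have G0 := comb 0 1; rewrite oner_eq0 orbT scale0r add0r scale1r in G0.
have {}G0 := G0 isT.
have := comb (dot3 v v) (- dot3 u v); rewrite (lt0r_neq0 G0) => /(_ isT).
have -> : dot3 (dot3 v v *: u + - dot3 u v *: v)
      (dot3 v v *: u + - dot3 u v *: v)
  = dot3 v v * (dot3 u u * dot3 v v - dot3 u v * dot3 v u).
  by move: u v {comb G0} => u v; rewrite {1}/dot3 !mxE /dot3; ring.
by rewrite pmulr_rgt0 // dot3_cross.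
Qed.

(** * Covariant derivatives in the half-space *)

Lemma hyp_dotE (R : realType) (p u v : 'rV[R]_3) :
  hyp_dot p u v = height p ^- 2 * dot3 u v.
Proof.
rewrite /hyp_dot /hyp_metric mul_mx_scalar -scalemxAl mxE; congr (_ * _).
by rewrite mxE sum3E !mxE.
Qed.

Lemma is_derive_height (R : realType) (p v : 'rV[R]_3) :
  is_derive p v (@height R) (height v).
Proof.
have D : derivable (@height R) p v.
  by apply: diff_derivable; apply: differentiable_coord.
apply: DeriveDef => //.
have := derive_mx (@derivable_id _ _ p v).
by rewrite derive_id => /(congr1 (@height R)); rewrite {2}/height mxE => ->.
Qed.

Lemma partial_hyp_metric (R : realType) (p : 'rV[R]_3) (i j l : 'I_3) :
  height p != 0 ->
  partial i (fun q => hyp_metric q j l) p =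
  - 2 * height p ^- 3 * (i == ord_max)%:R * (j == l)%:R.
Proof.
move=> z0; rewrite /partial.
have -> : (fun q : 'rV[R]_3 => hyp_metric q j l)
   = (j == l)%:R *: (fun q => (height q ^+ 2)^-1).
  by apply/funext => q; rewrite mxE -[LHS]mulr_natl.
have h := is_derive_height p (delta_mx 0 i).
have := is_deriveX 2 h; rewrite exprfctE => h2.
have z20 : height p ^+ 2 != 0 by rewrite expf_neq0.
have D2 : derivable (fun q => height q ^+ 2) p (delta_mx 0 i) by case: h2.
rewrite deriveZ; last exact: derivableV.
rewrite deriveV //.
have [_ ->] := h2.
rewrite [height (delta_mx _ _)]mxE eqxx /= (eq_sym ord_max i).
rewrite /GRing.scale /= expr1; field.
exact: z0.
Qed.

(** The usual Christoffel symbols of a metric conformal to the Euclidean one,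
    here with conformal factor [z ^- 2]. *)
Lemma christoffelE (R : realType) (k i j : 'I_3) (p : 'rV[R]_3) :
  height p != 0 ->
  christoffel k i j p = - (height p)^-1 *
   ((k == i)%:R * (j == ord_max)%:R + (k == j)%:R * (i == ord_max)%:R
    - (i == j)%:R * (k == ord_max)%:R).
Proof.
move=> z0; rewrite /christoffel (bigD1 k) //= big1 => [|l lk].
  rewrite !partial_hyp_metric // invmx_scalar mxE eqxx mulr1n addr0.
  rewrite (eq_sym j k) (eq_sym i k); field.
  exact: z0.
by rewrite invmx_scalar mxE eq_sym (negbTE lk) mulr0n mul0r.
Qed.

Lemma christoffel_contract (R : realType) (p u v : 'rV[R]_3) (k : 'I_3) :
  height p != 0 ->
  \sum_a \sum_b christoffel k a b p * u 0 a * v 0 b =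
  - (height p)^-1 * (height v * u 0 k + height u * v 0 k
                     - dot3 u v * d_z R 0 k).
Proof.
move=> z0; rewrite !sum3E !christoffelE // /dot3 /d_z mxE /height.
by elim/ord3P: k => /=; ring.
Qed.

(** The hyperbolic covariant derivative is the Euclidean second derivative plus
    tangential terms and a vertical term; of these corrections, only the
    vertical one contributes to the second fundamental form. *)
Lemma cov_diff2E (R : realType) (X : 'rV[R]_2 -> 'rV[R]_3) (x : 'rV[R]_2)
    (i j : 'I_2) :
  height (X x) != 0 ->
  let u := row i (diffmx X x) in
  let v := row j (diffmx X x) in
  cov_diff2 X i j x =
    (\row_k partial i (partial j (fun y => X y 0 k)) x)
    - (height (X x))^-1 *: (height v *: u + height u *: v - dot3 u v *: d_z R).
Proof.
move=> z0 u v; apply/rowP => k; rewrite mxE [RHS]mxE; congr (_ + _).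
  rewrite mxE; congr (partial i _ x); apply/funext => y; rewrite mxE //.
have -> : \sum_a \sum_b
      christoffel k a b (X x) * diffmx X x i a * diffmx X x j b
   = \sum_a \sum_b christoffel k a b (X x) * u 0 a * v 0 b.
  apply: eq_bigr => a _; apply: eq_bigr => b _.
  by rewrite [u 0 a]mxE [v 0 b]mxE.
rewrite christoffel_contract // mulNr.
by move: u v => u v; rewrite !mxE.
Qed.

(** * Mean curvature in Euclidean terms *)

Lemma det_mx2 (R : realType) (F : 'M[R]_2) :
  \det F = F 0 0 * F 1 1 - F 0 1 * F 1 0.
Proof.
have E : lift ord0 ord0 = 1 :> 'I_2 by exact: val_inj.
have E1 : lift 1 ord0 = 0 :> 'I_2 by exact: val_inj.
rewrite (expand_det_row _ 0) sum2E /cofactor !det_mx11 !mxE /=.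
by rewrite ?E ?E1 /= expr0 expr1; ring.
Qed.

(** The trace is the one of the adjugate of [F] times [S], which clears the
    denominators of the inverse. *)
Lemma tr_invmx_mul2 (R : realType) (F S : 'M[R]_2) : F \in unitmx ->
  \det F * \tr (invmx F *m S) =
  F 1 1 * S 0 0 - F 0 1 * S 1 0 - F 1 0 * S 0 1 + F 0 0 * S 1 1.
Proof.
move=> uF; rewrite det_mx2 /mxtrace sum2E.
have E : F *m (invmx F *m S) = S by rewrite mulKVmx.
move: (invmx F *m S) E => M <-.
by rewrite !mxE !sum2E; ring.
Qed.

Lemma first_formE (R : realType) (X : 'rV[R]_2 -> 'rV[R]_3) (x : 'rV[R]_2)
    (i j : 'I_2) :
  first_form X x i j = height (X x) ^- 2 *
    dot3 (row i (diffmx X x)) (row j (diffmx X x)).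
Proof.
rewrite /first_form mul_mx_scalar -scalemxAl mxE; congr (_ * _).
by rewrite mxE sum3E /dot3 !mxE.
Qed.

Lemma principal_curvatures_tr (R : realType) (X : 'rV[R]_2 -> 'rV[R]_3)
    (x : 'rV[R]_2) (k1 k2 : R) :
  principal_curvatures X x k1 k2 -> \tr (shape_operator X x) = k1 + k2.
Proof.
move=> E; have := @char_poly_trace _ 2 (shape_operator X x) isT.
rewrite E mulrBl !mulrBr -polyCM -expr2.
rewrite !coefB coefXn coefXM coefCM coefX !coefC /=.
rewrite mulr1 sub0r subr0 => H; apply: oppr_inj; rewrite -H opprD addrC //.
Qed.

Lemma dot3_cov (R : realType) (a b c d e : R) (w p q n : 'rV[R]_3) :
  dot3 (w - a *: (b *: p + c *: q - d *: d_z R)) (e *: n) =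
  e * (dot3 w n - a * (b * dot3 p n + c * dot3 q n - d * n 0 ord_max)).
Proof. by rewrite /dot3 !mxE /=; ring. Qed.

(** The scalar identity behind [mean_curvature_normal]: [E], [F], [G] are the
    Euclidean first fundamental form, [a], [b], [d], [c] the second derivatives
    of the surface paired with the normal, [e] the third coordinate of the
    normal and [nu] its hyperbolic length. *)
Lemma trace_algebra (R : realType) (z nu E F G a b c d e t : R) :
  z != 0 -> nu != 0 ->
  z ^- 4 * (E * G - F * F) * t =
    z ^- 2 * G * (z ^- 2 / nu * (a + E * e / z))
    - z ^- 2 * F * (z ^- 2 / nu * (d + F * e / z))
    - z ^- 2 * F * (z ^- 2 / nu * (b + F * e / z))
    + z ^- 2 * E * (z ^- 2 / nu * (c + G * e / z)) ->
  G * a - F * (b + d) + E * c = 2 * (E * G - F * F) * (nu * (t / 2) - e / z).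
Proof.
move=> zN nuN /(congr1 (fun s => z ^+ 4 * nu * s)).
have -> : z ^+ 4 * nu * (z ^- 4 * (E * G - F * F) * t)
  = nu * (E * G - F * F) * t by field.
set rhs := (X in _ = X).
have -> : rhs = G * a - F * (b + d) + E * c + 2 * (E * G - F * F) * (e / z).
  by rewrite /rhs; field; rewrite zN nuN.
by move=> K; rewrite -[LHS](addrK (2 * (E * G - F * F) * (e / z))) -K; field.
Qed.

(** This is the relation [H = z H_e + N_3] between the hyperbolic and the
    Euclidean mean curvature, with denominators cleared: the left-hand side
    pairs [n] with the trace of the second derivatives for the Euclidean induced
    metric, multiplied by the Gram determinant [dot3 n n] of that metric. *)
Lemma mean_curvature_normal (R : realType) (X : 'rV[R]_2 -> 'rV[R]_3)
    (x : 'rV[R]_2) (H : R) :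
  let u := row 0 (diffmx X x) in
  let v := row 1 (diffmx X x) in
  let n := cross u v in
  let h i j := \row_k partial i (partial j (fun y => X y 0 k)) x in
  let z := height (X x) in
  0 < z -> 0 < dot3 n n -> mean_curvature_is X x H ->
  dot3 v v * dot3 (h 0 0) n - dot3 u v * (dot3 (h 0 1) n + dot3 (h 1 0) n)
  + dot3 u u * dot3 (h 1 1) n
  = 2 * dot3 n n * (hyp_norm (X x) n * H - n 0 ord_max / z).
Proof.
move=> u v n h z z0 n0 [k1 [k2 [/principal_curvatures_tr tr ->]]].
have zN : z != 0 by rewrite lt0r_neq0.
have nu0 : 0 < hyp_norm (X x) n.
  by rewrite sqrtr_gt0 hyp_dotE mulr_gt0 // invr_gt0 exprn_gt0.
set nu := hyp_norm _ _ in nu0 *.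
have un : dot3 u n = 0.
  by have [e0 e1 e2] := crossE u v; rewrite /dot3 e0 e1 e2; ring.
have vn : dot3 v n = 0.
  by have [e0 e1 e2] := crossE u v; rewrite /dot3 e0 e1 e2; ring.
have S i j : second_form X x i j = z ^- 2 * nu^-1 * (dot3 (h i j) n
    + dot3 (row i (diffmx X x)) (row j (diffmx X x)) * n 0 ord_max / z).
  have rn (k : 'I_2) : dot3 (row k (diffmx X x)) n = 0.
    by elim/ord2P: k; [exact: un | exact: vn].
  rewrite mxE hyp_dotE cov_diff2E // dot3_cov !rn.
  rewrite -/u -/v -/n -/nu -/z -/(h i j).
  by field; rewrite zN lt0r_neq0.
have dF : \det (first_form X x) = z ^- 4 * dot3 n n.
  rewrite det_mx2 !first_formE -/u -/v -/z -dot3_cross; field; exact: zN.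
have uF : first_form X x \in unitmx.
  rewrite unitmxE unitfE dF mulf_neq0 ?invr_neq0 ?expf_neq0 ?lt0r_neq0 //.
have := tr_invmx_mul2 (second_form X x) uF.
rewrite -/(shape_operator X x) tr dF !S !first_formE -/u -/v -/z => K.
have C : dot3 v u = dot3 u v by rewrite /dot3; ring.
rewrite C in K.
have D := dot3_cross u v.
rewrite -/n C in D.
rewrite -D in K *.
exact: (trace_algebra zN (lt0r_neq0 nu0) K).
Qed.

(** * The distance to the vertical axis at a maximum *)

(** Let [P = (p0, p1, 0)] be the horizontal position, [a] and [b] the tangent
    vectors, [n] their cross product and [T] the trace of the second
    derivatives, scaled by the Gram determinant.  As [P] is orthogonal to [a] and
    [b], it is parallel to [n]; its third coordinate being zero,
    [(P . n) n2 = 0].  Since [T . n] is a multiple of [n2], it follows that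
    [P . T = 0].  The trace of the Hessian is then the horizontal part alone,
    which is [|n|^2 + n2^2 > 0], against the second derivative test. *)
Lemma no_max_coords (R : realFieldType) (a0 a1 a2 b0 b1 b2 p0 p1
    A0 A1 A2 B0 B1 B2 B0' B1' B2' C0 C1 C2 m : R) :
  let n0 := a1 * b2 - a2 * b1 in
  let n1 := a2 * b0 - a0 * b2 in
  let n2 := a0 * b1 - a1 * b0 in
  let E := a0 ^+ 2 + a1 ^+ 2 + a2 ^+ 2 in
  let F := a0 * b0 + a1 * b1 + a2 * b2 in
  let G := b0 ^+ 2 + b1 ^+ 2 + b2 ^+ 2 in
  let T0 := G * A0 - F * (B0 + B0') + E * C0 in
  let T1 := G * A1 - F * (B1 + B1') + E * C1 in
  let T2 := G * A2 - F * (B2 + B2') + E * C2 in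
  0 < n0 ^+ 2 + n1 ^+ 2 + n2 ^+ 2 ->
  p0 * a0 + p1 * a1 = 0 ->
  p0 * b0 + p1 * b1 = 0 ->
  T0 * n0 + T1 * n1 + T2 * n2 = n2 * m ->
  (forall s t, (s * a0 + t * b0) ^+ 2 + (s * a1 + t * b1) ^+ 2
    + (p0 * (s * s * A0 + s * t * B0 + t * s * B0' + t * t * C0)
     + p1 * (s * s * A1 + s * t * B1 + t * s * B1' + t * t * C1)) <= 0) ->
  False.
Proof.
move=> n0 n1 n2 E F G T0 T1 T2 npos Pa Pb HT H.
(* The next three identities are the coordinates of
   |n|^2 P - (P . n) n = (n x P) x n, with n x P = (P . a) b - (P . b) a. *)
have e0 : (n0 ^+ 2 + n1 ^+ 2 + n2 ^+ 2) * p0 = (p0 * n0 + p1 * n1) * n0.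
  have -> : (n0 ^+ 2 + n1 ^+ 2 + n2 ^+ 2) * p0 = (p0 * n0 + p1 * n1) * n0
     + (p0 * a0 + p1 * a1) * (b1 * n2 - b2 * n1)
     - (p0 * b0 + p1 * b1) * (a1 * n2 - a2 * n1) by rewrite /n0 /n1 /n2; ring.
  by rewrite Pa Pb; ring.
have e1 : (n0 ^+ 2 + n1 ^+ 2 + n2 ^+ 2) * p1 = (p0 * n0 + p1 * n1) * n1.
  have -> : (n0 ^+ 2 + n1 ^+ 2 + n2 ^+ 2) * p1 = (p0 * n0 + p1 * n1) * n1
     + (p0 * a0 + p1 * a1) * (b2 * n0 - b0 * n2)
     - (p0 * b0 + p1 * b1) * (a2 * n0 - a0 * n2) by rewrite /n0 /n1 /n2; ring.
  by rewrite Pa Pb; ring.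
have e2 : (p0 * n0 + p1 * n1) * n2 = 0.
  have -> : (p0 * n0 + p1 * n1) * n2 =
      (p0 * b0 + p1 * b1) * (a0 * n1 - a1 * n0)
     - (p0 * a0 + p1 * a1) * (b0 * n1 - b1 * n0) by rewrite /n0 /n1 /n2; ring.
  by rewrite Pa Pb; ring.
have K : p0 * T0 + p1 * T1 = 0.
  apply: (mulfI (lt0r_neq0 npos)); rewrite mulr0 mulrDr !mulrA e0 e1.
  have -> : (p0 * n0 + p1 * n1) * n0 * T0 + (p0 * n0 + p1 * n1) * n1 * T1
    = (p0 * n0 + p1 * n1) * (T0 * n0 + T1 * n1 + T2 * n2)
      - (p0 * n0 + p1 * n1) * n2 * T2 by ring.
  by rewrite HT mulrA e2; ring.
(* The adjugate of the Gram matrix is the sum over the three coordinates k of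
   w w^T with w = (b_k, - a_k), so adding the test in these directions gives
   the trace of the Hessian. *)
have := lerD (lerD (H b0 (- a0)) (H b1 (- a1))) (H b2 (- a2)).
rewrite leNgt => /negP; apply.
rewrite !addr0 [ltRHS](_ : _ = n0 ^+ 2 + n1 ^+ 2 + n2 ^+ 2 + n2 ^+ 2
   + (p0 * T0 + p1 * T1)).
  by rewrite K addr0 ltr_wpDr ?sqr_ge0.
rewrite /T0 /T1 /E /F /G /n0 /n1 /n2; ring.
Qed.

(** The same contradiction stated with the vectors that occur in
    [mean_curvature_normal]. *)
Lemma no_max_vectors (R : realType) (u v : 'rV[R]_3)
    (h : 'I_2 -> 'I_2 -> 'I_3 -> R) (p q m : R) :
  let n := cross u v in
  0 < dot3 n n ->
  dot3 v v * dot3 (\row_k h 0 0 k) n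
    - dot3 u v * (dot3 (\row_k h 0 1 k) n + dot3 (\row_k h 1 0 k) n)
    + dot3 u u * dot3 (\row_k h 1 1 k) n = n 0 ord_max * m ->
  (forall s t,
   p * (s * u 0 0 + t * v 0 0) + q * (s * u 0 1 + t * v 0 1) = 0 /\
   (s * u 0 0 + t * v 0 0) ^+ 2 + (s * u 0 1 + t * v 0 1) ^+ 2
   + (p * (s * s * h 0 0 0 + s * t * h 0 1 0
      + t * s * h 1 0 0 + t * t * h 1 1 0)
     + q * (s * s * h 0 0 1 + s * t * h 0 1 1
      + t * s * h 1 0 1 + t * t * h 1 1 1)) <= 0) ->
  False.
Proof.
move=> n; have [e0 e1 e2] := crossE u v.
rewrite !(dot3_row (h _ _)) /dot3 /n e0 e1 e2.
move: (h 0 0) (h 0 1) (h 1 0) (h 1 1) => A B B' C n0 K H.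
apply: (@no_max_coords R (u 0 0) (u 0 1) (u 0 ord_max)
  (v 0 0) (v 0 1) (v 0 ord_max) p q (A 0) (A 1) (A ord_max)
  (B 0) (B 1) (B ord_max) (B' 0) (B' 1) (B' ord_max)
  (C 0) (C 1) (C ord_max) m).
- by move: n0; rewrite -!expr2.
- by have [] := H 1 0; rewrite !mul1r !mul0r !addr0.
- by have [] := H 0 1; rewrite !mul1r !mul0r !add0r.
- by rewrite -K; ring.
- by move=> s t; have [] := H s t.
Qed.

(** For a horo-shrinker [H] is [z ^- 2] times the third coordinate of the unit
    normal, so by [mean_curvature_normal] the normal component of the trace of
    the second derivatives is a multiple of the third coordinate of [n]. *)
Lemma no_local_max (R : realType) (U : set 'rV[R]_2)
    (X : 'rV[R]_2 -> 'rV[R]_3) (x : 'rV[R]_2) :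
  open U -> smooth_on U X -> U x -> 0 < height (X x) ->
  row_free (diffmx X x) ->
  mean_curvature_is X x (hyp_dot (X x) (unit_normal X x) (d_z R)) ->
  (forall y, U y ->
    X y 0 0 ^+ 2 + X y 0 1 ^+ 2 <= X x 0 0 ^+ 2 + X x 0 1 ^+ 2) ->
  False.
Proof.
move=> oU sX Ux z0 /row_free_cross n0 mc Xmax.
have nuH : let n := cross (row 0 (diffmx X x)) (row 1 (diffmx X x)) in
    hyp_norm (X x) n * hyp_dot (X x) (unit_normal X x) (d_z R)
    = height (X x) ^- 2 * n 0 ord_max.
  move=> n; have nu0 : hyp_norm (X x) n != 0.
    by rewrite lt0r_neq0 // sqrtr_gt0 hyp_dotE mulr_gt0 // invr_gt0 exprn_gt0.
  rewrite hyp_dotE dot3_d_z /unit_normal -/n [(_ *: n) _ _]mxE.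
  by rewrite mulrCA mulVKf.
have K := mean_curvature_normal z0 n0 mc.
have {nuH} K := etrans K (congr1 (fun t => 2 * _ * (t - _)) nuH).
have nbU : \forall y \near x, U y := open_nbhs_nbhs (conj oU Ux).
pose p y := X y 0 0; pose q y := X y 0 1.
have Hmax (s t : R) :
    let w : 'rV[R]_2 := \row_i [:: s; t]`_i in
    p x * 'D_w p x + q x * 'D_w q x = 0 /\
    'D_w p x ^+ 2 + 'D_w q x ^+ 2
      + (p x * 'D_w ('D_w p) x + q x * 'D_w ('D_w q) x) <= 0.
  move=> w; apply: max_sum_sqr.
  - by apply: filterS nbU => y /Xmax.
  - apply: filterS nbU => y Uy.
    by have [] := (is_derive_partials w oU (sX 0 1%N) Uy,
                   is_derive_partials w oU (sX 1 1%N) Uy) => -[? _] [].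
  - by have [] := is_derive2_partials w oU (sX 0 2%N) Ux.
  - by have [] := is_derive2_partials w oU (sX 1 2%N) Ux.
have D1 (k : 'I_3) (s t : R) : let w : 'rV[R]_2 := \row_i [:: s; t]`_i in
    'D_w (fun y => X y 0 k) x =
      s * row 0 (diffmx X x) 0 k + t * row 1 (diffmx X x) 0 k.
  move=> w; have [_ ->] := is_derive_partials w oU (sX k 1%N) Ux.
  by rewrite sum2E !mxE.
pose h i j k := partial i (partial j (fun y => X y 0 k)) x.
have D2 (k : 'I_3) (s t : R) : let w : 'rV[R]_2 := \row_i [:: s; t]`_i in
    'D_w ('D_w (fun y => X y 0 k)) x = s * s * h 0 0 k + s * t * h 0 1 k
      + t * s * h 1 0 k + t * t * h 1 1 k.
  move=> w; have [_ E] := is_derive2_partials w oU (sX k 2%N) Ux.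
  apply: (etrans E); apply: (etrans (sum22E _)).
  have w0 : w 0 0 = s by rewrite mxE.
  have w1 : w 0 1 = t by rewrite mxE.
  by rewrite w0 w1.
have {}Hmax (s t : R) :
   p x * (s * row 0 (diffmx X x) 0 0 + t * row 1 (diffmx X x) 0 0)
   + q x * (s * row 0 (diffmx X x) 0 1 + t * row 1 (diffmx X x) 0 1) = 0 /\
   (s * row 0 (diffmx X x) 0 0 + t * row 1 (diffmx X x) 0 0) ^+ 2
   + (s * row 0 (diffmx X x) 0 1 + t * row 1 (diffmx X x) 0 1) ^+ 2
   + (p x * (s * s * h 0 0 0 + s * t * h 0 1 0
      + t * s * h 1 0 0 + t * t * h 1 1 0)
     + q x * (s * s * h 0 0 1 + s * t * h 0 1 1
      + t * s * h 1 0 1 + t * t * h 1 1 1)) <= 0.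
  pose w : 'rV[R]_2 := \row_i [:: s; t]`_i.
  have p1 : 'D_w p x = _ := D1 0 s t.
  have q1 : 'D_w q x = _ := D1 1 s t.
  have p2 : 'D_w ('D_w p) x = _ := D2 0 s t.
  have q2 : 'D_w ('D_w q) x = _ := D2 1 s t.
  have H : p x * 'D_w p x + q x * 'D_w q x = 0 /\
      'D_w p x ^+ 2 + 'D_w q x ^+ 2
      + (p x * 'D_w ('D_w p) x + q x * 'D_w ('D_w q) x) <= 0 := Hmax s t.
  move: ('D_w ('D_w p) x) ('D_w ('D_w q) x) ('D_w p x) ('D_w q x) p2 q2 p1 q1 H.
  by move=> p'' q'' p' q' -> -> -> ->.
pose n := cross (row 0 (diffmx X x)) (row 1 (diffmx X x)).
apply: (no_max_vectors (h := h) (m := 2 * dot3 n n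
  * (height (X x) ^- 2 - (height (X x))^-1)) n0 _ Hmax).
apply: (etrans K); rewrite /n.
by move: (dot3 _ _) (cross _ _ _ _) (height _)^-1 => a b c; ring.
Qed.

(** * Closed surfaces *)

(** Smoothness is only known for the composites of [Psi] with inverse charts;
    continuity on the surface itself is recovered from that of the charts. *)
Lemma immersion_coord_continuous (R : realType) (S : topologicalType)
    (A : set (chart R S)) (g : chart R S -> 'rV[R]_2 -> 'M[R]_2)
    (Psi : S -> 'rV[R]_3) (k : 'I_3) :
  oriented_surface A -> isometric_immersion A g Psi ->
  continuous (fun s => Psi s 0 k).
Proof.
move=> [_ _ cov _ _] [_ imm] s.
have [c Ac cs] : (\bigcup_(c in A) chart_dom c) s by rewrite cov.
have mc : {for s, continuous (chart_map c)}.
  have := @chart_map_continuous _ _ c.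
  rewrite continuous_open_subspace; last exact: chart_dom_open.
  by apply; rewrite inE.
have [sm _] := imm c Ac.
have Xc : {for chart_map c s, continuous (fun x => (Psi \o chart_inv c) x 0 k)}.
  by have [Xc _] := sm k 0%N; apply: Xc; exists s.
have H : (fun t => Psi (chart_inv c (chart_map c t)) 0 k) @ s
    --> Psi (chart_inv c (chart_map c s)) 0 k := continuous_comp mc Xc.
rewrite (chart_mapK cs) in H; apply: cvg_trans H; apply: near_eq_cvg.
apply: filterS (open_nbhs_nbhs (conj (chart_dom_open c) cs)) => y cy /=.
by rewrite (chart_mapK cy).
Qed.

Theorem proposition2p2 (R : realType) (S : topologicalType)
    (A : set (chart R S)) (g : chart R S -> 'rV[R]_2 -> 'M[R]_2)
    (Psi : S -> 'rV[R]_3) :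
  ~ (closed_oriented_surface A /\ horo_shrinker A g Psi).
Proof.
move=> [[oS cS] [_ _ immP Hmc]].
have cont k := immersion_coord_continuous (k := k) oS immP.
case: oS immP => [S0 _ cov _ _] [PsiH imm].
have [s _ smax] : exists2 s, s \in [set: S] & forall t, t \in [set: S] ->
    Psi t 0 0 ^+ 2 + Psi t 0 1 ^+ 2 <= Psi s 0 0 ^+ 2 + Psi s 0 1 ^+ 2.
  apply: (@compact_EVT_max S R
    (fun t => Psi t 0 0 ^+ 2 + Psi t 0 1 ^+ 2)) => //.
  apply: continuous_subspaceT => t.
  exact: (cvgD (cvgM (cont 0 t) (cont 0 t)) (cvgM (cont 1 t) (cont 1 t))).
have [c Ac cs] : (\bigcup_(c in A) chart_dom c) s by rewrite cov.
have [sm Xg] := imm c Ac.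
have cx : chart_cod c (chart_map c s) by exists s.
apply: (@no_local_max R (chart_cod c) (Psi \o chart_inv c) (chart_map c s)).
- exact: chart_cod_open.
- exact: sm.
- exact: cx.
- exact: PsiH.
- by have [] := Xg _ cx.
- exact: Hmc.
- by move=> y _ /=; rewrite (chart_mapK cs); apply: smax; rewrite inE.
Qed.
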